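(* Let $\tau:[0,\infty)\to[0,\infty)$ be continuous with $\lim_{t\to\infty}\{t-\tau(t)\}=\infty$, let $-\bar{\tau}=\inf_{t\ge 0}\{t-\tau(t)\}$, and suppose $\lim_{t\to\infty}\tau(t)/t=q$ for some $q\in(0,1)$. Let $g:[0,\infty)\to[0,\infty)$ be continuous with $g(0)=0$, $g(x)>0$ for $x>0$, such that there is $\delta_1>0$ for which $g$ is increasing on $(0,\delta_1)$, and there is $\beta>1$ with $g\in\mathrm{RV}_0(\beta)$. Let $a>b>0$ obey $$a>b\left(\frac{1}{1-q}\right)^{\beta/(\beta-1)}>0,$$ and define $$\Lambda=\left(a-b\left(\frac{1}{1-q}\right)^{\beta/(\beta-1)}\right)^{-1/(\beta-1)}>0.$$ Let $\psi\in C([-\bar\tau,0];(0,\infty))$. If the solution $x$ of $$x'(t)=-ag(x(t))+bg(x(t-\tau(t))),\quad t\ge 0;\qquad x(t)=\psi(t),\quad t\in[-\bar\tau,0],$$ obeys $x(t)\to0$ as $t\to\infty$, and $G(x)=\int_x^1\frac{1}{g(u)}\,du$ for $x>0$, then there is $\Lambda_0>0$ such that $$0<\Lambda_0\le\liminf_{t\to\infty}\frac{G(x(t))}{t}\le\limsup_{t\to\infty}\frac{G(x(t))}{t}\le\Lambda^{-(\beta-1)}.$$ Moreover $$\Lambda\le\liminf_{t\to\infty}\frac{x(t)}{G^{-1}(t)}\le\limsup_{t\to\infty}\frac{x(t)}{G^{-1}(t)}<+\infty.$$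
   Context: A function $f$, positive near $0$ on the right, is regularly varying at zero with exponent $\alpha\in\mathbb{R}$, written $f\in\mathrm{RV}_0(\alpha)$, if $\lim_{t\to0^+}f(\lambda t)/f(t)=\lambda^\alpha$ for all $\lambda>0$. A solution of the delay equation is a continuous function $x:[-\bar\tau,\infty)\to(0,\infty)$, differentiable on $[0,\infty)$ (one-sided at $0$), satisfying the equation for all $t\ge0$ and equal to $\psi$ on $[-\bar\tau,0]$; solutions are positive. $G$ is strictly decreasing on $(0,\infty)$ with $G(x)\to\infty$ as $x\to0^+$, and $G^{-1}$ is its inverse. *)

(* Defs.v *)
From mathcomp Require Import all_boot all_order all_algebra.
From mathcomp Require Import all_classical all_reals all_analysis.
Set Implicit Arguments.
Unset Strict Implicit.
Unset Printing Implicit Defensive.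
Import Order.TTheory GRing.Theory Num.Theory.
Import numFieldNormedType.Exports.
Local Open Scope classical_set_scope.
Local Open Scope ring_scope.

Definition regularly_varying_at_zero (R : realType) (alpha : R) (f : R -> R) :=
  (\forall t \near 0^'+, 0 < f t) /\
  (forall lambda : R, 0 < lambda ->
     f (lambda * t) / f t @[t --> 0^'+] --> lambda `^ alpha).

Definition history_length (R : realType) (tau : R -> R) : R :=
  - inf [set t - tau t | t in `[0, +oo[].

(* A function on [-taubar, +oo[ is represented by a total function on R whose
   values to the left of -taubar play no role; hence the derivative at 0 has to
   be stated as a right derivative, since for taubar = 0 nothing is known about
   x on the left of 0 (and for taubar > 0 only continuity of psi is). *)
Record is_solution (R : realType) (a b : R) (g tau psi x : R -> R) : Prop :=
  IsSolution {
    sol_continuous : {within `[- history_length tau, +oo[, continuous x};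
    sol_gt0 : forall t : R, - history_length tau <= t -> 0 < x t;
    sol_init : forall t : R, - history_length tau <= t <= 0 -> x t = psi t;
    sol_deriv0 :
      h^-1 * (x h - x 0) @[h --> 0^'+] -->
        - a * g (x 0) + b * g (x (0 - tau 0));
    sol_deriv : forall t : R, 0 < t ->
      is_derive t 1 x (- a * g (x t) + b * g (x (t - tau t))) }.

(* The integral from x to 1 is oriented, so G is negative on ]1, +oo[. *)
Definition G (R : realType) (g : R -> R) (x : R) : R :=
  if x <= 1 then \int[lebesgue_measure]_(u in `[x, 1]) (g u)^-1
  else - \int[lebesgue_measure]_(u in `[1, x]) (g u)^-1.

(* Inverse of G on ]0, +oo[; the default 0 is taken only outside the range of
   G, which for the nonlinearities of interest contains [0, +oo[. *)
Definition Ginv (R : realType) (g : R -> R) : R -> R :=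
  'pinv_(fun=> 0) `]0, +oo[ (G g).

Definition Lambda (R : realType) (a b q beta : R) : R :=
  (a - b * (1 / (1 - q)) `^ (beta / (beta - 1))) `^ (- 1 / (beta - 1)).

Definition liminf_at_infinity (R : realType) (f : R -> R) : \bar R :=
  limf_einf (fun t : R => (f t)%:E) (pinfty_nbhs R).

Definition limsup_at_infinity (R : realType) (f : R -> R) : \bar R :=
  limf_esup (fun t : R => (f t)%:E) (pinfty_nbhs R).

(* Main.v *)
Require Import Defs.
From mathcomp Require Import all_boot all_order all_algebra.
From mathcomp Require Import all_classical all_reals all_analysis.
From mathcomp Require Import lra ring.
Import Order.TTheory GRing.Theory Num.Theory.
Import numFieldNormedType.Exports.
Local Open Scope classical_set_scope.
Local Open Scope ring_scope.

(** Along a solution put y(t) = G(x(t)).  Since G' = - 1/g, the equation becomes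
    y'(t) = a - b g(x(t - tau t)) / g(x(t)), so everything rests on comparing g
    at two points u, v through a comparison of G(u) with G(v).

    The function G is regularly varying at zero with exponent 1 - beta: for c
    below (above) rho^(1-beta), the ratio of the derivatives of G(rho u) and
    c G(u) has limit rho^(1-beta)/c, and G blows up at 0, so G(rho u)
    eventually dominates (is dominated by) c G(u).  As G is decreasing, this
    inverts: G(v) <= c G(u) forces v >= rho u.  With the monotonicity and
    regular variation of g, a ratio s of values of G turns into a ratio
    s^(-beta/(beta-1)) of values of g, up to errors as small as desired
    ([g_ge_of_G_le], [g_le_of_G_ge]).

    The lag satisfies t - tau t ~ (1-q) t.  Suppose y grows linearly, that is
    y(t) ~ M t: then y(t - tau t)/y(t) ~ 1 - q and y' ~ kappa, where
    kappa = a - b (1-q)^(-beta/(beta-1)); so M can only be kappa.  Two one-sided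
    arguments replace the assumption that y(t)/t has a limit.
    - Lower bound ([G_solution_lower]): when y first meets a line lambda t of
      small slope from above, the past of y lies above that line, hence
      y' >= 3 kappa/4 > lambda there, which excludes the meeting.
    - Upper bound ([G_solution_upper]): let M > kappa be such that y is
      eventually below every steeper line.  Where y exceeds (M - e) t, its
      lagged value is at most about (1-q) y, hence y' < M - 2e, and y is driven
      below (M - e) t for good ([G_solution_upper_step]).  So the infimum of
      the admissible slopes is kappa.

    Finally G(x(t)) <= M t = M G(Ginv t) and G(x(t)) >= lambda G(Ginv t) give
    the bounds on x(t)/Ginv(t), by the same inversion of G; and
    Lambda^(-(beta-1)) = kappa. *)

Set Implicit Arguments.
Unset Strict Implicit.
Unset Printing Implicit Defensive.

(** * One-variable calculus *)

Lemma derivable_within_continuous_cc (R : realType) (f df : R -> R) (a b : R) :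
  (forall t, a <= t <= b -> is_derive t 1 f (df t)) ->
  {within `[a, b], continuous f}.
Proof.
move=> fdf; apply: derivable_within_continuous => t /=; rewrite in_itv /=.
by move=> /fdf [].
Qed.

Lemma is_derive_le_slope (R : realType) (f df : R -> R) (k a b : R) : a <= b ->
  (forall t, a <= t <= b -> is_derive t 1 f (df t)) ->
  (forall t, a <= t <= b -> df t <= k) ->
  f b - f a <= k * (b - a).
Proof.
move=> ab fdf dfk.
have fdf_oo t : t \in `]a, b[ -> is_derive t 1 f (df t).
  by rewrite in_itv /= => /andP[/ltW at' /ltW tb]; apply: fdf; rewrite at'.
have [c cab ->] := MVT_segment ab fdf_oo (derivable_within_continuous_cc fdf).
by rewrite ler_wpM2r ?subr_ge0// dfk//; move: cab; rewrite in_itv.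
Qed.

Lemma is_derive_linear (R : realType) (k t : R) : is_derive t 1 (fun t => k * t) k.
Proof. by rewrite -[X in is_derive _ _ _ X]mulr1; exact: is_deriveZ. Qed.

Lemma near_right0P (R : realType) (P : set R) :
  (\forall u \near 0^'+, P u) <->
  exists2 d : R, 0 < d & forall u, 0 < u < d -> P u.
Proof.
split=> [[d /= d0 dP]|[d d0 dP]].
  exists d => // u /andP[u0 ud]; apply: dP => //=.
  by rewrite sub0r normrN gtr0_norm.
near=> u; apply: dP; apply/andP; split; near: u.
  exact: nbhs_right_gt.
exact: nbhs_right_lt.
Unshelve. all: by end_near. Qed.

Lemma near_right0_scale (R : realType) (rho : R) (P : set R) : 0 < rho ->
  (\forall u \near 0^'+, P u) -> \forall u \near 0^'+, P (rho * u).
Proof.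
move=> rho0 /near_right0P[d d0 dP]; apply/near_right0P; exists (d / rho).
  exact: divr_gt0.
move=> u /andP[u0 ud]; apply: dP; rewrite mulr_gt0//=.
by rewrite mulrC -ltr_pdivlMr.
Qed.

Lemma near_pinftyP (R : realType) (P : set R) :
  (\forall t \near +oo, P t) <-> exists2 T : R, 0 < T & forall t, T < t -> P t.
Proof.
split=> [[T [_ TP]]|[T _ TP]]; last by exists T; split => //; exact: num_real.
exists (Num.max T 1); first by rewrite lt_max ltr01 orbT.
by move=> t; rewrite gt_max => /andP[Tt _]; exact: TP.
Qed.

(** The infimum of the times at which z is positive would be a zero of z that
    is a first crossing, where the derivative is negative.  The history starts
    at T1, before T, because for a delay equation the sign of the derivative
    depends on the past. *)
Lemma barrier (R : realType) (z dz : R -> R) (T1 T : R) :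
  (forall t, T <= t -> is_derive t 1 z (dz t)) ->
  T1 <= T -> (forall t, T1 <= t <= T -> z t <= 0) ->
  (forall t, T <= t -> (forall s, T1 <= s <= t -> z s <= 0) -> z t = 0 -> dz t < 0) ->
  forall t, T1 <= t -> z t <= 0.
Proof.
move=> z_diff T1T z_init z_cross t2 T1t2; rewrite leNgt; apply/negP => zt2.
have z_cont t : T <= t -> {for t, continuous z}.
  move=> /z_diff[dz_t _].
  by apply: differentiable_continuous; apply/derivable1_diffP.
pose A := [set t | T <= t /\ 0 < z t].
have At2 : A t2.
  split => //; rewrite leNgt; apply/negP => /ltW t2T.
  by move: zt2; rewrite ltNge z_init// T1t2.
have lbA : lbound A T by move=> t [].
have infA : has_inf A by split; [exists t2|exists T].
pose s := inf A.
have Ts : T <= s by apply: lb_le_inf => //; exists t2.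
have z_before t : T1 <= t -> t < s -> z t <= 0.
  move=> T1t ts; have [tT|Tt] := leP t T; first by rewrite z_init// T1t.
  rewrite leNgt; apply/negP => zt; move: ts; rewrite ltNge => /negP; apply.
  by apply: ge_inf; [exists T|split => //; exact: ltW].
have zs_le0 : z s <= 0.
  rewrite leNgt; apply/negP => zs.
  have Tlts : T < s.
    rewrite lt_neqAle Ts andbT; apply/eqP => sT.
    by move: zs; rewrite -sT ltNge z_init// lexx andbT.
  have z_pos_left : \forall t \near s^'-, 0 < z t.
    by apply: (cvgr_gt (z s)) => //; apply: cvg_at_left_filter; exact: z_cont.
  near s^'- => t; have zt : 0 < z t by near: t.
  have ts : t < s by near: t; exact: nbhs_left_lt.
  have Tt : T < t by near: t; exact: nbhs_left_gt.
  by move: zt; rewrite ltNge z_before// (le_trans T1T)// ltW.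
(* z s <= 0 already yields z <= 0 on a right neighbourhood of s, by continuity
   or, if z s = 0, by the sign of the derivative. *)
have z_le0_right : \forall t \near s^'+, z t <= 0.
  move: zs_le0; rewrite le_eqVlt => /predU1P[zs0|zs_lt0].
    have dzs : dz s < 0.
      apply: z_cross => // t /andP[T1t]; rewrite le_eqVlt => /predU1P[->|ts].
        by rewrite zs0.
      exact: z_before.
    have [/cvg_ex[l zl] dzE] := z_diff s Ts.
    have {dzE} lE : l = dz s by rewrite -dzE; apply/esym/cvg_lim.
    rewrite lE in zl.
    have : \forall h \near 0^'+, h^-1 *: (z (h *: 1 + s) - z s) < 0.
      by apply: (cvgr_lt (dz s)) => //; exact: cvg_dnbhs_at_right zl.
    move=> quot_lt0; apply/nbhs_right0P; near=> h.
    have h0 : 0 < h by near: h; exact: nbhs_right_gt.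
    have : h^-1 *: (z (h *: 1 + s) - z s) < 0 by near: h.
    rewrite zs0 subr0 /GRing.scale/= mulr1 pmulr_rlt0 ?invr_gt0// addrC.
    exact: ltW.
  near=> t; apply/ltW; near: t.
  by apply: (cvgr_lt (z s)) => //; apply: cvg_at_right_filter; exact: z_cont.
move: z_le0_right => /nbhs_right0P/near_right0P[e e0 ze].
have [t [Tt zt] ts] := inf_adherent e0 infA.
have st : s <= t by apply: ge_inf; [exists T|split].
move: zt; rewrite ltNge => /negP; apply.
move: st; rewrite le_eqVlt => /predU1P[<-//|st].
have := ze (t - s); rewrite (addrC s) subrK; apply.
by rewrite subr_gt0 st/= ltrBlDl.
Unshelve. all: by end_near. Qed.

(** * Limits inferior and superior at infinity *)

Section limit_superior.
Variables (R : realType) (f : R -> R).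

Lemma limsup_at_infinity_le (K : R) :
  (forall M, K < M -> \forall t \near +oo, f t <= M) ->
  (limsup_at_infinity f <= K%:E)%E.
Proof.
move=> fM; apply/lee_addgt0Pr => e e0; rewrite -EFinD.
rewrite /limsup_at_infinity limf_esupE; apply: ge_ereal_inf.
exists (ereal_sup [set (f t)%:E | t in [set t | f t <= K + e]]).
  by exists [set t | f t <= K + e] => //; apply: fM; rewrite ltrDl.
by apply/ereal_supP => _ [t /= ft <-]; rewrite lee_fin.
Qed.

Lemma liminf_at_infinity_ge (K : R) :
  (forall M, M < K -> \forall t \near +oo, M <= f t) ->
  (K%:E <= liminf_at_infinity f)%E.
Proof.
move=> fM; apply/lee_subgt0Pr => e e0; rewrite -EFinB.
rewrite /liminf_at_infinity limf_einfE; apply: le_ereal_sup_tmp.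
exists (ereal_inf [set (f t)%:E | t in [set t | K - e <= f t]]).
  by exists [set t | K - e <= f t] => //; apply: fM; rewrite ltrBlDr ltrDl.
by apply/ereal_infP => _ [t /= ft <-]; rewrite lee_fin.
Qed.

Lemma liminf_le_limsup_at_infinity :
  (liminf_at_infinity f <= limsup_at_infinity f)%E.
Proof.
rewrite /liminf_at_infinity /limsup_at_infinity limf_einfE limf_esupE.
apply/ereal_supP => _ [V Voo <-]; apply/ereal_infP => _ [W Woo <-].
have [t [Vt Wt]] := filter_ex (filterI Voo Woo).
apply: (@le_trans _ _ (f t)%:E).
  by apply: ereal_inf_lbound; exists t.
by apply: ereal_sup_ubound; exists t.
Qed.

End limit_superior.

Section limit_of_quotients.
Variables (R : realType) (f : R -> R).

Lemma limsup_div_id_le (K : R) :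
  (forall M, K < M -> \forall t \near +oo, f t <= M * t) ->
  (limsup_at_infinity (fun t => (f t / t)%R) <= K%:E)%E.
Proof.
move=> f_le; apply: limsup_at_infinity_le => M KM; near=> t.
rewrite ler_pdivrMr; last by near: t; exact: nbhs_pinfty_gt (num_real _).
by near: t; exact: f_le.
Unshelve. all: by end_near. Qed.

Lemma liminf_div_id_ge (K : R) : (\forall t \near +oo, K * t <= f t) ->
  (K%:E <= liminf_at_infinity (fun t => (f t / t)%R))%E.
Proof.
move=> f_ge; apply: liminf_at_infinity_ge => M MK; near=> t.
have t0 : 0 < t by near: t; exact: nbhs_pinfty_gt (num_real _).
rewrite ler_pdivlMr//; apply: (@le_trans _ _ (K * t)).
  by rewrite ler_wpM2r// ltW.
by near: t.
Unshelve. all: by end_near. Qed.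

End limit_of_quotients.

(** * The function G: derivative and monotonicity *)

Section antiderivative.
Variables (R : realType) (g : R -> R).
Hypothesis g_continuous : {within `[0, +oo[, continuous g}.
Hypothesis g_gt0 : forall u : R, 0 < u -> 0 < g u.

Lemma continuous_of_gt0 (u : R) : 0 < u -> {for u, continuous g}.
Proof.
move=> u0; have [+ _] := (continuous_within_itvcyP 0 g).1 g_continuous.
by apply; rewrite in_itv /= u0.
Qed.

Lemma continuous_inv_of_gt0 (u : R) : 0 < u -> {for u, continuous (fun u => (g u)^-1)}.
Proof.
move=> u0; apply: cvgV; first by rewrite gt_eqF// g_gt0.
exact: continuous_of_gt0.
Qed.

Lemma integrable_inv (a b : R) : 0 < a ->
  (@lebesgue_measure R).-integrable `[a, b] (EFin \o (fun u => (g u)^-1)).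
Proof.
move=> a0; apply: continuous_compact_integrable; first exact: segment_compact.
apply: continuous_in_subspaceT => u /set_mem /=; rewrite in_itv /= => /andP[au _].
by apply: continuous_inv_of_gt0; exact: lt_le_trans au.
Qed.

(** A common base point a below both 1 and u removes the case distinction in the
    definition of G, so that the fundamental theorem of calculus applies on both
    sides of 1, and at 1. *)
Lemma G_eq_integrals (a u : R) : 0 < a -> a < 1 -> a < u ->
  G g u = \int[lebesgue_measure]_(v in `[a, 1]) (g v)^-1
        - \int[lebesgue_measure]_(v in `[a, u]) (g v)^-1.
Proof.
have integ_oc c d : 0 < c -> (@lebesgue_measure R).-integrable `]c, d]
    (EFin \o (fun u => (g u)^-1)).
  move=> c0; apply: (integrableS _ _ _ (integrable_inv d c0)) => //.
  by apply: subset_itv => //; rewrite bnd_simp.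
move=> a0 a1 au; rewrite /G; case: ifPn => u1.
  rewrite Rintegral_itvB ?bnd_simp//; [|exact: integrable_inv|exact: ltW].
  by rewrite Rintegral_itv_obnd_cbnd//; apply: integ_oc; exact: lt_trans au.
rewrite -ltNge in u1; apply: oppr_inj; rewrite opprK opprB.
rewrite Rintegral_itvB ?bnd_simp//; [|exact: integrable_inv|exact: ltW|exact: ltW].
by rewrite Rintegral_itv_obnd_cbnd//; exact: integ_oc.
Qed.

Lemma is_derive_G (u : R) : 0 < u -> is_derive u 1 (G g) (- (g u)^-1).
Proof.
move=> u0; pose a := Num.min u 1 / 2.
have m0 : 0 < Num.min u 1 by rewrite lt_min u0 ltr01.
have a0 : 0 < a by rewrite divr_gt0.
have am : a < Num.min u 1 by rewrite /a; lra.
have [au a1] : a < u /\ a < 1 by move: am; rewrite lt_min => /andP[].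
have uu1 : u < u + 1 by rewrite ltrDl.
have [dF F'] := continuous_FTC1_closed uu1 (integrable_inv (u + 1) a0) au
  (continuous_inv_of_gt0 u0).
pose c := \int[lebesgue_measure]_(v in `[a, 1]) (g v)^-1.
apply: (@near_eq_is_derive _ _ _ (fun t => c -
    \int[lebesgue_measure]_(v in `[a, t]) (g v)^-1)).
  by near=> t; rewrite (@G_eq_integrals a)//; near: t; exact: lt_nbhsr.
rewrite -[- _]add0r; apply: is_deriveB.
by apply: DeriveDef; [exact: dF|rewrite -derive1E; exact: F'].
Unshelve. all: by end_near. Qed.

Lemma continuous_G (u : R) : 0 < u -> {for u, continuous (G g)}.
Proof.
move=> /is_derive_G [dG _].
by apply: differentiable_continuous; apply/derivable1_diffP.
Qed.

Lemma G_decreasing (u v : R) : 0 < u -> u < v -> G g v < G g u.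
Proof.
move=> u0 uv.
have dG t : u <= t <= v -> is_derive t 1 (G g) (- (g t)^-1).
  by move=> /andP[ut _]; apply: is_derive_G; exact: lt_le_trans ut.
have dG_oo t : t \in `]u, v[ -> is_derive t 1 (G g) (- (g t)^-1).
  by rewrite in_itv /= => /andP[/ltW ut /ltW tv]; apply: dG; rewrite ut.
have [c] := MVT uv dG_oo (derivable_within_continuous_cc dG).
rewrite in_itv /= => /andP[uc _] eqG.
have c0 : 0 < (g c)^-1 by rewrite invr_gt0 g_gt0// (lt_trans u0).
by rewrite -subr_lt0 eqG mulNr oppr_lt0 mulr_gt0// subr_gt0.
Qed.

Lemma le_G (u v : R) : 0 < u -> 0 < v -> (G g u <= G g v) = (v <= u).
Proof.
move=> u0 v0; apply/idP/idP => [|vu].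
  by apply: contraTT; rewrite -!ltNge; exact: G_decreasing.
by move: vu; rewrite le_eqVlt => /predU1P[->//|vu]; exact/ltW/G_decreasing.
Qed.

End antiderivative.

(** * Conjugate exponents *)

Section power_identities.
Variables (R : realType) (beta : R).
Hypothesis beta_gt1 : 1 < beta.

Let exponent_gt0 : 0 < (beta - 1) / beta.
Proof. by rewrite divr_gt0 ?subr_gt0// (lt_trans ltr01). Qed.

Lemma powR_1B (rho : R) : 0 < rho -> rho `^ (1 - beta) = rho / rho `^ beta.
Proof.
move=> rho0; rewrite powRB; last by rewrite (gt_eqF rho0) implybT.
by rewrite powRr1// ltW.
Qed.

(** For rho = r^(1/beta) one has rho^beta = r, and r < s^(-beta/(beta-1)) is the
    same as s < rho^(1-beta): this converts ratios of values of G, of exponent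
    1 - beta, into ratios of values of g, of exponent beta. *)
Lemma powR_conjugate_gt (s r : R) : 0 < s -> 0 < r ->
  (s < (r `^ beta^-1) `^ (1 - beta)) = (r < s `^ (- (beta / (beta - 1)))).
Proof.
move=> s0 r0; rewrite -powRrM /powR !gt_eqF//.
rewrite -{1}(lnK s0) -{2}(lnK r0) !ltr_expR -[RHS](ltr_pM2l exponent_gt0).
have -> : (beta - 1) / beta * (- (beta / (beta - 1)) * ln s) = - ln s.
  by field; rewrite subr_eq0 !gt_eqF// (lt_trans ltr01).
by rewrite [RHS]ltrNr; congr (_ < _); field; rewrite gt_eqF// (lt_trans ltr01).
Qed.

Lemma powR_conjugate_lt (s r : R) : 0 < s -> 0 < r ->
  ((r `^ beta^-1) `^ (1 - beta) < s) = (s `^ (- (beta / (beta - 1))) < r).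
Proof.
move=> s0 r0; rewrite -powRrM /powR !gt_eqF//.
rewrite -{1}(lnK s0) -{2}(lnK r0) !ltr_expR -[RHS](ltr_pM2l exponent_gt0).
have -> : (beta - 1) / beta * (- (beta / (beta - 1)) * ln s) = - ln s.
  by field; rewrite subr_eq0 !gt_eqF// (lt_trans ltr01).
by rewrite [RHS]ltrNl; congr (_ < _); field; rewrite gt_eqF// (lt_trans ltr01).
Qed.

End power_identities.

(** * Regular variation of G at zero *)

Section regular_variation.
Variables (R : realType) (g : R -> R) (beta : R).
Hypothesis g_continuous : {within `[0, +oo[, continuous g}.
Hypothesis g_gt0 : forall u : R, 0 < u -> 0 < g u.
Hypothesis beta_gt1 : 1 < beta.
Hypothesis g_RV : regularly_varying_at_zero beta g.

Let is_derive_G := is_derive_G g_continuous g_gt0.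
Let le_G := le_G g_continuous g_gt0.

Lemma is_derive_G_scale (rho u : R) : 0 < rho -> 0 < u ->
  is_derive u 1 (fun t => G g (rho * t)) (- (g (rho * u))^-1 * rho).
Proof.
move=> rho0 u0; apply: (@is_derive1_comp _ (G g) ( *%R rho)).
  by apply: is_derive_G; rewrite mulr_gt0.
exact: is_derive_linear.
Qed.

(** Since beta > 1, g(u/2) <= g(u)/2 near 0, so G(u/2) - G(u) is nonincreasing
    in u: halving u repeatedly adds at least a fixed amount to G. *)
Lemma G_cvgy : G g u @[u --> 0^'+] --> +oo.
Proof.
have half_lt : (2^-1 : R) `^ beta < 2^-1.
  rewrite /powR gt_eqF ?invr_gt0// -[ltRHS]lnK ?posrE ?invr_gt0// ltr_expR.
  have : ln (2^-1 : R) < 0 by apply: ln_lt0; lra.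
  by move: beta_gt1; nra.
have [u0 u0_gt0 gu0] : exists2 d : R, 0 < d & forall u, 0 < u < d ->
    g (2^-1 * u) / g u < 2^-1.
  by apply/near_right0P; apply: cvgr_lt half_lt; apply: g_RV.2.
pose u1 := u0 / 2.
have u1_gt0 : 0 < u1 by rewrite divr_gt0.
have u1_lt : u1 < u0 by rewrite /u1; lra.
pose d := G g (2^-1 * u1) - G g u1.
have d0 : 0 < d.
  by rewrite subr_gt0; apply: G_decreasing => //; lra.
have step u : 0 < u <= u1 -> d <= G g (2^-1 * u) - G g u.
  move=> /andP[u_gt0 uu1].
  rewrite -subr_le0 -[leRHS](mul0r (u1 - u)).
  apply: (@is_derive_le_slope _ (fun t => G g (2^-1 * t) - G g t)
    (fun t => - (g (2^-1 * t))^-1 * 2^-1 - (- (g t)^-1)) 0) => //.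
    move=> t /andP[ut _]; apply: is_deriveB.
      by apply: is_derive_G_scale => //; lra.
    by apply: is_derive_G; lra.
  move=> t /andP[ut tu1].
  have t_gt0 : 0 < t by lra.
  have t2_gt0 : 0 < 2^-1 * t by lra.
  have := gu0 t ltac:(lra); rewrite ltr_pdivrMr ?g_gt0// => lt_g.
  have := g_gt0 t2_gt0; have := g_gt0 t_gt0 => p1 p2.
  rewrite mulNr opprK addrC subr_le0 mulrC.
  by rewrite ler_pdivlMr// mulrC -ler_pdivlMr ?invr_gt0// invrK ltW.
have half_pow n : 0 < (2^-1 : R) ^+ n <= 1.
  by rewrite exprn_gt0//= exprn_ile1//; lra.
have iter_step n : G g u1 + d *+ n <= G g (2^-1 ^+ n * u1).
  elim: n => [|n ih]; first by rewrite expr0 mul1r mulr0n addr0.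
  rewrite exprS mulrSr addrA -mulrA.
  have /andP[pn0 pn1] := half_pow n.
  set w := 2^-1 ^+ n * u1 in ih *.
  have w_range : 0 < w <= u1.
    by rewrite mulr_gt0//= /w -[leRHS]mul1r ler_wpM2r// ltW.
  have := step w w_range.
  rewrite lerBrDl; apply: le_trans.
  by rewrite lerD2r.
apply/cvgryPge => A.
have [n An] : exists n : nat, A <= G g u1 + d *+ n.
  exists (Num.truncn `|(A - G g u1) / d|).+1.
  rewrite -lerBlDl -mulr_natr -ler_pdivrMl// mulrC.
  by apply: (le_trans (ler_norm _)); rewrite ltW// truncnS_gt.
apply/near_right0P; exists (2^-1 ^+ n * u1); first by rewrite mulr_gt0 ?exprn_gt0.
move=> u /andP[u_gt0 /ltW uu]; apply: (le_trans An); apply: (le_trans (iter_step n)).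
by rewrite le_G// mulr_gt0 ?exprn_gt0.
Qed.

(** A one-sided L'Hopital rule: for c' strictly between c and rho^(1-beta),
    G(rho u) - c' G(u) is nonincreasing near 0, hence bounded below there, and
    (c' - c) G(u) absorbs the bound as G tends to infinity. *)
Lemma G_scale_ge (rho c : R) : 0 < rho -> c < rho `^ (1 - beta) ->
  \forall u \near 0^'+, c * G g u <= G g (rho * u).
Proof.
move=> rho0 c_lt; pose c' := (c + rho `^ (1 - beta)) / 2.
have cc' : c < c' by rewrite /c'; lra.
have c'_lt : c' < rho `^ (1 - beta) by rewrite /c'; lra.
have [d d0 gd] : exists2 d : R, 0 < d & forall u, 0 < u < d ->
    c' * (g (rho * u) / g u) < rho.
  apply/near_right0P; apply: (@cvgr_lt _ _ _ _ _ (c' * rho `^ beta)).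
    by apply: cvgM; [exact: cvg_cst|exact: g_RV.2].
  by rewrite -ltr_pdivlMr ?powR_gt0// -powR_1B.
pose u1 := d / 2.
have u1_range : 0 < u1 < d by rewrite /u1; lra.
pose phi t := G g (rho * t) - c' * G g t.
have phi_ge u : 0 < u <= u1 -> phi u1 <= phi u.
  move=> u_range; rewrite -subr_le0 -[leRHS](mul0r (u1 - u)).
  apply: (@is_derive_le_slope _ phi
    (fun t => - (g (rho * t))^-1 * rho - c' *: - (g t)^-1)); first by lra.
    move=> t ut; apply: is_deriveB.
      by apply: is_derive_G_scale => //; lra.
    by apply: is_deriveZ; apply: is_derive_G; lra.
  move=> t ut.
  have t0 : 0 < t by lra.
  have := gd t ltac:(lra).
  have p1 := g_gt0 t0; have p2 : 0 < g (rho * t) by rewrite g_gt0// mulr_gt0.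
  rewrite mulrA ltr_pdivrMr// => lt_g.
  rewrite /GRing.scale/= mulrN opprK mulNr addrC subr_le0 ler_pdivrMr//.
  by rewrite -mulrA ler_pdivlMl// mulrC ltW.
near=> u.
have u_gt0 : 0 < u by near: u; exact: nbhs_right_gt.
have u_le : u <= u1.
  by near: u; apply: nbhs_right_le; case/andP: u1_range.
have phiu := phi_ge u ltac:(by rewrite u_gt0 u_le).
have : - phi u1 / (c' - c) <= G g u.
  by near: u; apply: (cvgry_ge G_cvgy).
by rewrite ler_pdivrMr ?subr_gt0//; move: phiu; rewrite {2}/phi; lra.
Unshelve. all: by end_near. Qed.

(** The lower estimate for 1/rho and 1/c, applied at rho u. *)
Lemma G_scale_le (rho c : R) : 0 < rho -> rho `^ (1 - beta) < c ->
  \forall u \near 0^'+, G g (rho * u) <= c * G g u.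
Proof.
move=> rho0 c_gt.
have p0 : 0 < rho `^ (1 - beta) by rewrite powR_gt0.
have c0 : 0 < c := lt_trans p0 c_gt.
have ge_inv : \forall u \near 0^'+, c^-1 * G g u <= G g (rho^-1 * u).
  apply: G_scale_ge; rewrite ?invr_gt0//.
  by rewrite -[rho^-1]powR_inv1 ?(ltW rho0)// -powRrM mulN1r powRN ltf_pV2 ?posrE.
near=> u.
have : c^-1 * G g (rho * u) <= G g (rho^-1 * (rho * u)).
  by near: u; exact: near_right0_scale ge_inv.
by rewrite mulKf ?gt_eqF// ler_pdivrMl.
Unshelve. all: by end_near. Qed.

(** G(v) <= c G(u) <= G(rho u), and G is decreasing.  Leaving v arbitrary makes
    this the regular variation of the inverse of G, in a form that does not
    mention the inverse. *)
Lemma ge_scale_of_G_le (rho c : R) : 0 < rho -> c < rho `^ (1 - beta) ->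
  \forall u \near 0^'+, forall v, 0 < v -> G g v <= c * G g u -> rho * u <= v.
Proof.
move=> rho0 c_lt; near=> u => v v0 Gv.
have u0 : 0 < u by near: u; exact: nbhs_right_gt.
rewrite -le_G// ?mulr_gt0//; apply: (le_trans Gv).
by near: u; exact: G_scale_ge.
Unshelve. all: by end_near. Qed.

Lemma le_scale_of_G_ge (rho c : R) : 0 < rho -> rho `^ (1 - beta) < c ->
  \forall u \near 0^'+, forall v, 0 < v -> c * G g u <= G g v -> v <= rho * u.
Proof.
move=> rho0 c_gt; near=> u => v v0 Gv.
have u0 : 0 < u by near: u; exact: nbhs_right_gt.
rewrite -le_G// ?mulr_gt0//; apply: le_trans Gv.
by near: u; exact: G_scale_le.
Unshelve. all: by end_near. Qed.

Variable delta1 : R.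
Hypothesis delta1_gt0 : 0 < delta1.
Hypothesis g_nondecreasing : {in `]0, delta1[ &, nondecreasing_fun g}.

Let g_le (u v : R) : 0 < u -> u <= v -> v < delta1 -> g u <= g v.
Proof.
move=> u0 uv vd; apply: g_nondecreasing => //; rewrite in_itv /=.
  by rewrite u0 (le_lt_trans uv).
by rewrite (lt_le_trans u0).
Qed.

(** If G(v)/G(u) is at most s then, heuristically, v >= s^(-1/(beta-1)) u and
    g(v)/g(u) >= s^(-beta/(beta-1)).  The slack between r and the latter pays
    for a constant c slightly larger than s. *)
Lemma g_ge_of_G_le (s r : R) :
  0 < s -> 0 < r -> r < s `^ (- (beta / (beta - 1))) ->
  exists2 c, s < c & \forall u \near 0^'+, forall v, 0 < v < delta1 ->
    G g v <= c * G g u -> r * g u <= g v.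
Proof.
move=> s0 r0 r_lt; set S := s `^ _ in r_lt; pose r' := (r + S) / 2.
have [rr' r'S] : r < r' /\ r' < S by rewrite /r'; split; lra.
have r'0 : 0 < r' := lt_trans r0 rr'.
pose rho := r' `^ beta^-1.
have rho0 : 0 < rho by rewrite powR_gt0.
have rhoE : rho `^ beta = r'.
  by rewrite /rho -powRrM mulVf ?powRr1 ?ltW// gt_eqF// (lt_trans ltr01).
have s_lt : s < rho `^ (1 - beta) by rewrite powR_conjugate_gt.
pose c := (s + rho `^ (1 - beta)) / 2.
have [sc c_lt] : s < c /\ c < rho `^ (1 - beta) by rewrite /c; split; lra.
exists c => //; near=> u => v /andP[v0 vd] Gv.
have u0 : 0 < u by near: u; exact: nbhs_right_gt.
have rho_uv : rho * u <= v.
  move: v v0 Gv {vd}; near: u; exact: ge_scale_of_G_le.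
apply: le_trans (g_le _ rho_uv vd); last by rewrite mulr_gt0.
rewrite -ler_pdivlMr ?g_gt0// ltW//; near: u.
by apply: (cvgr_gt (rho `^ beta)); [exact: g_RV.2|rewrite rhoE].
Unshelve. all: by end_near. Qed.

Lemma g_le_of_G_ge (s r : R) : 0 < s -> s `^ (- (beta / (beta - 1))) < r ->
  exists2 c, 0 < c < s & \forall u \near 0^'+, forall v, 0 < v ->
    c * G g u <= G g v -> g v <= r * g u.
Proof.
move=> s0; set S := s `^ _ => r_gt; pose r' := (r + S) / 2.
have [r'r Sr'] : r' < r /\ S < r' by rewrite /r'; split; lra.
have r'0 : 0 < r' by apply: lt_trans Sr'; rewrite powR_gt0.
pose rho := r' `^ beta^-1.
have rho0 : 0 < rho by rewrite powR_gt0.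
have rhoE : rho `^ beta = r'.
  by rewrite /rho -powRrM mulVf ?powRr1 ?ltW// gt_eqF// (lt_trans ltr01).
have lt_s : rho `^ (1 - beta) < s by rewrite powR_conjugate_lt.
pose c := (s + rho `^ (1 - beta)) / 2.
have [cs c_gt] : c < s /\ rho `^ (1 - beta) < c by rewrite /c; split; lra.
exists c; first by rewrite cs andbT (lt_trans _ c_gt)// powR_gt0.
near=> u => v v0 Gv.
have u0 : 0 < u by near: u; exact: nbhs_right_gt.
have v_rhou : v <= rho * u.
  by move: v v0 Gv; near: u; exact: le_scale_of_G_ge.
have rho_ud : rho * u < delta1.
  near: u; apply: (@near_right0_scale _ rho [set w | w < delta1]) => //.
  exact: nbhs_right_lt.
apply: (le_trans (g_le v0 v_rhou rho_ud)).
rewrite -ler_pdivrMr ?g_gt0// ltW//; near: u.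
by apply: (cvgr_lt (rho `^ beta)); [exact: g_RV.2|rewrite rhoE].
Unshelve. all: by end_near. Qed.

End regular_variation.

(** * Growth of G along a solution *)

Section delay_equation.
Variables (R : realType) (tau g x : R -> R) (q beta a b delta1 : R).
Hypothesis tau_ge0 : forall t : R, 0 <= t -> 0 <= tau t.
Hypothesis tau_lag : t - tau t @[t --> +oo] --> +oo.
Hypothesis q_in01 : 0 < q < 1.
Hypothesis tau_ratio : tau t / t @[t --> +oo] --> q.
Hypothesis g_continuous : {within `[0, +oo[, continuous g}.
Hypothesis g_gt0 : forall u : R, 0 < u -> 0 < g u.
Hypothesis delta1_gt0 : 0 < delta1.
Hypothesis g_nondecreasing : {in `]0, delta1[ &, nondecreasing_fun g}.
Hypothesis beta_gt1 : 1 < beta.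
Hypothesis g_RV : regularly_varying_at_zero beta g.
Hypothesis b_gt0 : 0 < b.
Hypothesis x_gt0 : forall t : R, 0 <= t -> 0 < x t.
Hypothesis x_deriv : forall t : R, 0 < t ->
  is_derive t 1 x (- a * g (x t) + b * g (x (t - tau t))).
Hypothesis x_to0 : x t @[t --> +oo] --> 0.

(** When y = G o x is close to a line through the origin, gain is the asymptotic
    ratio g(x(t - tau t)) / g(x t), and kappa the asymptotic slope of y. *)
Let gain := (1 - q) `^ (- (beta / (beta - 1))).
Let kappa := a - b * gain.
Hypothesis kappa_gt0 : 0 < kappa.

Let y t := G g (x t).
Let dy t := a - b * (g (x (t - tau t)) / g (x t)).

Let q1_gt0 : 0 < 1 - q.
Proof. by case/andP: q_in01 => _; rewrite subr_gt0. Qed.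

Let gain_gt0 : 0 < gain.
Proof. by rewrite powR_gt0. Qed.

Lemma is_derive_G_solution (t : R) : 0 < t -> is_derive t 1 y (dy t).
Proof.
move=> t0; have xt0 := x_gt0 (ltW t0); have gxt := g_gt0 xt0.
have -> : dy t = - (g (x t))^-1 * (- a * g (x t) + b * g (x (t - tau t))).
  by rewrite /dy; field; rewrite gt_eqF.
apply: (@is_derive1_comp _ (G g) x); first exact: is_derive_G.
exact: x_deriv.
Qed.

Lemma near_lag (P : set R) : (\forall t \near +oo, P t) ->
  \forall t \near +oo, P (t - tau t).
Proof. exact: tau_lag. Qed.

Lemma near_solution (P : set R) : (\forall u \near 0^'+, P u) ->
  \forall t \near +oo, P (x t).
Proof.
move=> /near_right0P[d d0 dP]; near=> t; apply: dP.
have t0 : 0 <= t by near: t; exact: nbhs_pinfty_ge (num_real _).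
rewrite x_gt0//=.
by near: t; apply: (cvgr_lt 0).
Unshelve. all: by end_near. Qed.

Lemma near_lag_le (c : R) : 1 - q < c -> \forall t \near +oo, t - tau t <= c * t.
Proof.
move=> c_gt; near=> t.
have t0 : 0 < t by near: t; exact: nbhs_pinfty_gt (num_real _).
have : 1 - c < tau t / t by near: t; apply: (cvgr_gt q) => //; lra.
rewrite ltr_pdivlMr//; nra.
Unshelve. all: by end_near. Qed.

Lemma near_lag_ge (c : R) : c < 1 - q -> \forall t \near +oo, c * t <= t - tau t.
Proof.
move=> c_lt; near=> t.
have t0 : 0 < t by near: t; exact: nbhs_pinfty_gt (num_real _).
have : tau t / t < 1 - c by near: t; apply: (cvgr_lt q) => //; lra.
rewrite ltr_pdivrMr//; nra.
Unshelve. all: by end_near. Qed.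

Lemma G_solution_cvgy (A : R) : \forall t \near +oo, A <= y t.
Proof.
have := near_solution (cvgry_ge (G_cvgy g_continuous g_gt0 beta_gt1 g_RV) A).
exact.
Qed.

(** Up to time T only y >= 1 is known, so lambda must be at most 1/T; at any
    later meeting with the line lambda t one has y' >= 3 kappa/4, so lambda must
    also be smaller than that. *)
Lemma G_solution_lower :
  exists2 lambda : R, 0 < lambda & \forall t \near +oo, lambda * t <= y t.
Proof.
(* This r makes a - b r = 3 kappa / 4. *)
pose r := gain + kappa / (4 * b).
have kb : 0 < kappa / (4 * b) by rewrite divr_gt0// mulr_gt0.
have br : b * r = a - 3 / 4 * kappa.
  by rewrite /r mulrDr /kappa; field; rewrite gt_eqF.
have gain_r : gain < r by rewrite ltrDl.
have [c /andP[c0 cq] g_le] :=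
  g_le_of_G_ge g_continuous g_gt0 beta_gt1 g_RV delta1_gt0 g_nondecreasing q1_gt0 gain_r.
have [T1 T1_gt0 y1] := (near_pinftyP _).1 (G_solution_cvgy 1).
have : \forall t \near +oo, [/\ T1 + 1 <= t - tau t, c * t <= t - tau t &
    forall v, 0 < v -> c * y t <= G g v -> g v <= r * g (x t)].
  near=> t; split; near: t.
  - exact: near_lag (nbhs_pinfty_ge (num_real _)).
  - exact: near_lag_ge.
  - exact: near_solution g_le.
move=> /near_pinftyP[T0 T0_gt0 T0P].
pose T := T0 + T1 + 1.
have T_gt0 : 0 < T by rewrite /T; lra.
pose lambda := Num.min (kappa / 4) T^-1.
have lambda_gt0 : 0 < lambda by rewrite lt_min invr_gt0 T_gt0 divr_gt0.
have lambda_kappa : lambda <= kappa / 4 by rewrite ge_min lexx.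
have lambda_T : lambda <= T^-1 by rewrite ge_min lexx orbT.
exists lambda => //.
suff z_le0 t : T1 + 1 <= t -> lambda * t - y t <= 0.
  near=> t; rewrite -subr_le0; apply: z_le0; near: t.
  exact: nbhs_pinfty_ge (num_real _).
apply: (@barrier _ (fun t => lambda * t - y t) (fun t => lambda - dy t)
  (T1 + 1) T) => {t}.
- move=> t Tt; apply: is_deriveB; first exact: is_derive_linear.
  by apply: is_derive_G_solution; exact: lt_le_trans Tt.
- by rewrite /T; lra.
- move=> t /andP[T1t tT]; rewrite subr_le0; apply: le_trans (y1 t _); last by lra.
  apply: (@le_trans _ _ (T^-1 * T)); last by rewrite mulVf// gt_eqF.
  by apply: ler_pM => //; [exact: ltW|lra].
- move=> t Tt before zt0.
  have [lag1 lagc g_le_t] := T0P t ltac:(rewrite /T in Tt; lra).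
  have t0 : 0 < t by rewrite (lt_le_trans T_gt0).
  have tau0 := tau_ge0 (ltW t0).
  have yt : y t = lambda * t by lra.
  have := before (t - tau t) ltac:(lra); rewrite subr_le0 => y_lag.
  have c_y : c * y t <= y (t - tau t).
    rewrite yt mulrCA; apply: le_trans y_lag.
    by rewrite ler_wpM2l// ltW.
  have x_lag0 : 0 < x (t - tau t) by apply: x_gt0; lra.
  have ratio : g (x (t - tau t)) / g (x t) <= r.
    by rewrite ler_pdivrMr ?(g_gt0 (x_gt0 (ltW t0)))//; exact: g_le_t.
  have : b * (g (x (t - tau t)) / g (x t)) <= b * r by rewrite ler_wpM2l// ltW.
  rewrite /dy br; lra.
Unshelve. all: by end_near. Qed.

(** If y is below the line of slope M + e, then at a time when it is above the
    line of slope M - e its lagged value is at most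
    (M + e) (1 - q + e) / (M - e) y(t), a ratio that tends to 1 - q as e
    tends to 0; so y' < M - 2e at such a time, and y - (M - e) t decreases at a
    rate at least e as long as it is nonnegative. *)
Lemma G_solution_upper_step (M : R) : kappa < M ->
  exists2 e : R, 0 < e & (\forall t \near +oo, y t <= (M + e) * t) ->
    \forall t \near +oo, y t <= (M - e) * t.
Proof.
have gain0 := gain_gt0; move=> kM; have M0 : 0 < M := lt_trans kappa_gt0 kM.
(* r is positive, below gain, and a - b r < M. *)
pose r := (Num.max ((a - M) / b) 0 + gain) / 2.
have lt_gain : Num.max ((a - M) / b) 0 < gain.
  by rewrite gt_max gain_gt0 andbT ltr_pdivrMr// mulrC; rewrite /kappa in kM; lra.
have ge_max0 : 0 <= Num.max ((a - M) / b) 0 by rewrite le_max lexx orbT.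
have r_gt0 : 0 < r by rewrite /r; lra.
have r_gain : r < gain by rewrite /r; lra.
have aMbr : a - M < b * r.
  have : (a - M) / b < r.
    apply: (@le_lt_trans _ _ (Num.max ((a - M) / b) 0)); first by rewrite le_max lexx.
    by rewrite /r; lra.
  by rewrite ltr_pdivrMr// mulrC.
have [c qc g_ge] :=
  g_ge_of_G_le g_continuous g_gt0 beta_gt1 g_RV g_nondecreasing q1_gt0 r_gt0 r_gain.
have [e [e0 e_small e_M e_rate]] : exists e : R, [/\ 0 < e,
    (M + e) * (1 - q + e) <= c * (M - e), e < M & a - b * r < M - e - e].
  pose k := M + 2 - q + c.
  have q1 := q1_gt0; have k0 : 0 < k by rewrite /k; lra.
  have D0 : 0 < M * (c - (1 - q)) by rewrite mulr_gt0// subr_gt0.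
  near (0 : R)^'+ => e; exists e.
  have e0 : 0 < e by near: e; exact: nbhs_right_gt.
  have e1 : e < 1 by near: e; exact: nbhs_right_lt.
  have eM : e < M by near: e; exact: nbhs_right_lt.
  have ek : e < M * (c - (1 - q)) / k by near: e; apply: nbhs_right_lt; rewrite divr_gt0.
  have er : e < (M - (a - b * r)) / 2.
    by near: e; apply: nbhs_right_lt; rewrite divr_gt0//; lra.
  split => //; last by lra.
  (* With e < 1, the error terms of e_small add up to less than e k. *)
  move: ek; rewrite ltr_pdivlMr// /k => ek; nra.
exists e => // y_le.
have : \forall t \near +oo, [/\ y (t - tau t) <= (M + e) * (t - tau t),
    t - tau t <= (1 - q + e) * t, 0 < x (t - tau t) < delta1 &
    forall v, 0 < v < delta1 -> G g v <= c * y t -> r * g (x t) <= g v].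
  near=> t; split; last by near: t; exact: near_solution g_ge.
  - by near: t; exact: near_lag y_le.
  - by near: t; apply: near_lag_le; rewrite ltrDl.
  - near: t; apply: (@near_lag [set s | 0 < x s < delta1]).
    apply: (@near_solution [set u | 0 < u < delta1]); apply/near_right0P.
    by exists delta1.
move=> /near_pinftyP[T T_gt0 TP].
pose z t := y t - (M - e) * t.
pose dz t := dy t - (M - e).
have z_diff t : T <= t -> is_derive t 1 z (dz t).
  move=> Tt; apply: is_deriveB; last exact: is_derive_linear.
  by apply: is_derive_G_solution; exact: lt_le_trans Tt.
have dz_le t : T < t -> 0 <= z t -> dz t <= - e.
  move=> Tt; rewrite subr_ge0 => y_ge.
  have [y_lag lag_le x_lag g_ge_t] := TP t Tt.
  have t0 : 0 < t := lt_trans T_gt0 Tt.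
  have Gx_le : y (t - tau t) <= c * y t.
    apply: (le_trans y_lag); apply: (@le_trans _ _ ((M + e) * ((1 - q + e) * t))).
      by rewrite ler_wpM2l// addr_ge0// ltW.
    rewrite mulrA; apply: (@le_trans _ _ (c * (M - e) * t)).
      by rewrite ler_wpM2r// ltW.
    by rewrite -mulrA ler_wpM2l// ltW// (lt_trans q1_gt0).
  have ratio : r <= g (x (t - tau t)) / g (x t).
    by rewrite ler_pdivlMr ?(g_gt0 (x_gt0 (ltW t0)))//; exact: g_ge_t.
  have : b * r <= b * (g (x (t - tau t)) / g (x t)) by rewrite ler_wpM2l// ltW.
  rewrite /dz /dy; lra.
(* z cannot stay positive: it would lose e per unit of time. *)
have [t1 [Tt1 zt1]] : exists t1, T < t1 /\ z t1 <= 0.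
  apply: contrapT => no_t1.
  have z_gt0 t : T < t -> 0 < z t.
    by move=> Tt; rewrite ltNge; apply/negP => zt; apply: no_t1; exists t.
  pose t0 := T + 1; pose t2 := t0 + z t0 / e.
  have zt0 : 0 < z t0 by apply: z_gt0; rewrite ltrDl.
  have t02 : t0 < t2 by rewrite ltrDl divr_gt0.
  have : z t2 - z t0 <= - e * (t2 - t0).
    apply: (@is_derive_le_slope _ z dz); first exact: ltW.
      by move=> t /andP[t0t _]; apply: z_diff; rewrite (le_trans _ t0t)// lerDl.
    move=> t /andP[t0t _]; have Tt : T < t by rewrite (lt_le_trans _ t0t)// ltrDl.
    by apply: dz_le => //; exact/ltW/z_gt0.
  have -> : - e * (t2 - t0) = - z t0.
    by rewrite /t2; field; rewrite gt_eqF.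
  have : 0 < z t2 by apply: z_gt0; rewrite (lt_trans _ t02)// ltrDl.
  lra.
have z_le0 t : t1 <= t -> z t <= 0.
  apply: (@barrier _ z dz t1 t1) => // {t}.
  - by move=> t t1t; apply: z_diff; lra.
  - by move=> t; rewrite -eq_le => /eqP<-.
  - move=> t t1t _ zt; have := @dz_le t ltac:(lra) ltac:(lra); lra.
near=> t; rewrite -subr_le0; apply: z_le0; near: t.
exact: nbhs_pinfty_ge (num_real _).
Unshelve. all: by end_near. Qed.

(** The crude bound y' <= a, valid once the lagged time is nonnegative, provides
    a first slope.  The infimum of the slopes M >= kappa such that y <= M t
    eventually cannot exceed kappa, since the previous lemma would lower it. *)
Lemma G_solution_upper (M : R) : kappa < M -> \forall t \near +oo, y t <= M * t.
Proof.
pose A := [set K | kappa <= K /\ \forall t \near +oo, y t <= K * t].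
have lbA : has_lbound A by exists kappa => K [].
have A_a1 : A (a + 1).
  split; first by rewrite /kappa; have : 0 < b * gain by [rewrite mulr_gt0]; lra.
  have [T T_gt0 lag_ge0] :=
    (near_pinftyP _).1 (near_lag (nbhs_pinfty_ge (num_real (0 : R)))).
  pose T1 := T + 1; have TT1 : T < T1 by rewrite ltrDl.
  near=> t.
  have slope : y t - y T1 <= a * (t - T1).
    apply: (@is_derive_le_slope _ y dy) => [|s /andP[T1s _]|s /andP[T1s _]].
    - by near: t; exact: nbhs_pinfty_ge (num_real _).
    - by apply: is_derive_G_solution; lra.
    - have := lag_ge0 s ltac:(lra) => /= lag_s.
      rewrite /dy gerBl mulr_ge0 ?(ltW b_gt0)// divr_ge0// ltW// g_gt0// x_gt0//.
      lra.
  have : y T1 - a * T1 <= t by near: t; exact: nbhs_pinfty_ge (num_real _).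
  lra.
have infA : has_inf A by split => //; exists (a + 1).
have inf_ge : kappa <= inf A by apply: lb_le_inf; [exists (a + 1)|move=> K []].
have inf_eq : inf A = kappa.
  apply/eqP; rewrite eq_le inf_ge andbT leNgt; apply/negP => kappa_lt.
  have [e e0 step] := G_solution_upper_step kappa_lt.
  have [K [_ yK] K_lt] := inf_adherent e0 infA.
  have : A (Num.max kappa (inf A - e)).
    split; first by rewrite le_max lexx.
    near=> t; apply: (@le_trans _ _ ((inf A - e) * t)).
      near: t; apply: step; near=> t; apply: (@le_trans _ _ (K * t)).
        by near: t.
      by rewrite ler_wpM2r ?(ltW K_lt)//; near: t; exact: nbhs_pinfty_ge (num_real _).
    rewrite ler_wpM2r ?le_max ?lexx ?orbT//; near: t; exact: nbhs_pinfty_ge (num_real _).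
  move=> /(ge_inf lbA); apply/negP; rewrite -ltNge gt_max kappa_lt/=; lra.
rewrite -inf_eq -subr_gt0 => /inf_adherent -/(_ A infA)[K [_ yK]].
rewrite subrKC => K_lt; near=> t; apply: (@le_trans _ _ (K * t)).
  by near: t.
by rewrite ler_wpM2r ?(ltW K_lt)//; near: t; exact: nbhs_pinfty_ge (num_real _).
Unshelve. all: by end_near. Qed.

End delay_equation.

(** * Comparison with the inverse of G *)

Section inverse.
Variables (R : realType) (g : R -> R) (beta : R).
Hypothesis g_continuous : {within `[0, +oo[, continuous g}.
Hypothesis g_gt0 : forall u : R, 0 < u -> 0 < g u.
Hypothesis beta_gt1 : 1 < beta.
Hypothesis g_RV : regularly_varying_at_zero beta g.

Lemma G_injective : {in `]0, +oo[%classic &, injective (G g)}.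
Proof.
move=> u v /set_mem/=; rewrite in_itv/= andbT => u0 /set_mem/=.
rewrite in_itv/= andbT => v0 Guv; apply/eqP.
rewrite eq_le -(le_G g_continuous g_gt0 v0 u0) -(le_G g_continuous g_gt0 u0 v0).
by rewrite Guv lexx.
Qed.

Lemma GinvP (t : R) : G g 1 <= t -> 0 < Ginv g t /\ G g (Ginv g t) = t.
Proof.
move=> Gt.
have [d d0 Gd] := (near_right0P _).1
  (cvgry_ge (G_cvgy g_continuous g_gt0 beta_gt1 g_RV) t).
pose u := Num.min (d / 2) 1.
have u0 : 0 < u by rewrite lt_min ltr01 divr_gt0.
have ud : u < d by rewrite gt_min ltr_pdivrMr// ltr_pMr// ltr1n.
have u1 : u <= 1 by rewrite ge_min lexx orbT.
have Gu : t <= G g u by apply: Gd; rewrite u0.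
have G_cont : {within `[u, 1], continuous (G g)}.
  apply: continuous_in_subspaceT => v /set_mem/=; rewrite in_itv/= => /andP[uv _].
  by apply: continuous_G => //; exact: lt_le_trans uv.
have [|w] := IVT u1 G_cont (v := t).
  by rewrite ge_min Gt orbT le_max Gu.
rewrite in_itv/= => /andP[uw _] Gw.
have w0 : 0 < w := lt_le_trans u0 uw.
have -> : Ginv g t = w.
  rewrite -Gw /Ginv pinvKV//; last by apply/mem_set; rewrite /= in_itv/= w0.
  exact: G_injective.
by [].
Qed.

Lemma near_Ginv (P : set R) : (\forall u \near 0^'+, P u) ->
  \forall t \near +oo, P (Ginv g t).
Proof.
move=> /near_right0P[d d0 dP]; near=> t.
have t1 : G g 1 <= t by near: t; exact: nbhs_pinfty_ge (num_real _).
have td : G g d < t by near: t; exact: nbhs_pinfty_gt (num_real _).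
have [w0 Gw] := GinvP t1.
by apply: dP; rewrite w0/= ltNge -(le_G g_continuous g_gt0 w0 d0) Gw -ltNge.
Unshelve. all: by end_near. Qed.

Lemma near_GinvP :
  \forall t \near +oo, 0 < Ginv g t /\ G g (Ginv g t) = t.
Proof.
near=> t; apply: GinvP.
by near: t; exact: nbhs_pinfty_ge (num_real _).
Unshelve. all: by end_near. Qed.

(** Writing t = G(Ginv t) makes G(y t) <= c t a comparison of two values of
    G. *)
Lemma ratio_Ginv_ge (y : R -> R) (c rho : R) : 0 < rho -> c < rho `^ (1 - beta) ->
  (\forall t \near +oo, 0 < y t /\ G g (y t) <= c * t) ->
  \forall t \near +oo, rho <= y t / Ginv g t.
Proof.
move=> rho0 c_lt y_le; near=> t.
have [w0 Gw] : 0 < Ginv g t /\ G g (Ginv g t) = t by near: t; exact: near_GinvP.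
have [y0 Gy] : 0 < y t /\ G g (y t) <= c * t by near: t.
rewrite ler_pdivlMr//; move: Gy; rewrite -[X in c * X]Gw.
move: (y t) y0; near: t.
apply: (@near_Ginv [set u | forall v, 0 < v -> G g v <= c * G g u -> rho * u <= v]).
exact: (ge_scale_of_G_le g_continuous g_gt0 beta_gt1 g_RV).
Unshelve. all: by end_near. Qed.

Lemma ratio_Ginv_le (y : R -> R) (c rho : R) : 0 < rho -> rho `^ (1 - beta) < c ->
  (\forall t \near +oo, 0 < y t /\ c * t <= G g (y t)) ->
  \forall t \near +oo, y t / Ginv g t <= rho.
Proof.
move=> rho0 c_gt y_ge; near=> t.
have [w0 Gw] : 0 < Ginv g t /\ G g (Ginv g t) = t by near: t; exact: near_GinvP.
have [y0 Gy] : 0 < y t /\ c * t <= G g (y t) by near: t.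
rewrite ler_pdivrMr//; move: Gy; rewrite -[X in c * X]Gw.
move: (y t) y0; near: t.
apply: (@near_Ginv [set u | forall v, 0 < v -> c * G g u <= G g v -> v <= rho * u]).
exact: (le_scale_of_G_ge g_continuous g_gt0 beta_gt1 g_RV).
Unshelve. all: by end_near. Qed.

Lemma liminf_ratio_Ginv_ge (y : R -> R) (kappa L : R) :
  0 < L -> L `^ (- (beta - 1)) = kappa -> (\forall t \near +oo, 0 < y t) ->
  (forall M, kappa < M -> \forall t \near +oo, G g (y t) <= M * t) ->
  (L%:E <= liminf_at_infinity (fun t => (y t / Ginv g t)%R))%E.
Proof.
move=> L0 Lkappa y0 y_le; apply: liminf_at_infinity_ge => M M_lt.
(* M may be nonpositive, while powers of rho need rho > 0. *)
pose rho := Num.max M (L / 2).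
have rho_gt0 : 0 < rho by rewrite lt_max divr_gt0// orbT.
have rho_lt : rho < L by rewrite gt_max M_lt/= ltr_pdivrMr// ltr_pMr// ltr1n.
have kappa_lt : kappa < rho `^ (1 - beta).
  rewrite -Lkappa -(opprB beta 1) !powRN ltf_pV2 ?posrE ?powR_gt0//.
  by rewrite gt0_ltr_powR ?subr_gt0// nnegrE ltW.
have [kc c_lt] := (midf_lt kappa_lt).
near=> t; apply: (@le_trans _ _ rho); first by rewrite le_max lexx.
near: t; apply: ratio_Ginv_ge c_lt _ => //.
by near=> t; split; near: t => //; exact: y_le.
Unshelve. all: by end_near. Qed.

Lemma limsup_ratio_Ginv_lty (y : R -> R) (lambda : R) :
  0 < lambda -> (\forall t \near +oo, 0 < y t) ->
  (\forall t \near +oo, lambda * t <= G g (y t)) ->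
  (limsup_at_infinity (fun t => (y t / Ginv g t)%R) < +oo)%E.
Proof.
move=> lambda0 y0 y_ge.
(* This rho solves rho^(1-beta) = lambda / 2, and lambda / 2 < lambda. *)
pose rho := (lambda / 2) `^ (1 - beta)^-1.
have rho_gt0 : 0 < rho by rewrite powR_gt0// divr_gt0.
have rho_lt : rho `^ (1 - beta) < lambda.
  rewrite -powRrM mulVf; last by rewrite subr_eq0 lt_eqF.
  rewrite powRr1; last by apply/ltW; rewrite divr_gt0.
  by rewrite ltr_pdivrMr// ltr_pMr// ltr1n.
apply: (@le_lt_trans _ _ rho%:E); last exact: ltry.
apply: limsup_at_infinity_le => M rhoM; near=> t; apply: le_trans (ltW rhoM).
near: t; apply: ratio_Ginv_le rho_lt _ => //.
by near=> t; split; near: t.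
Unshelve. all: by end_near. Qed.

End inverse.

(** * The asymptotics of positive solutions *)

(** The term t = 0 of the infimum is - tau 0 <= 0; and the infimum of a set
    that is not bounded below is 0 by convention. *)
Lemma history_length_ge0 (R : realType) (tau : R -> R) :
  (forall t, 0 <= t -> 0 <= tau t) -> 0 <= history_length tau.
Proof.
move=> tau_ge0; rewrite /history_length oppr_ge0.
set A := (X in inf X); have [[_ lbA]|] := pselect (has_inf A); last first.
  by move=> /inf_out ->.
apply: le_trans (_ : 0 - tau 0 <= 0); last by rewrite sub0r oppr_le0 tau_ge0.
by apply: ge_inf => //; exists 0 => //=; rewrite in_itv/= lexx.
Qed.

Theorem theorem7 (R : realType) (tau g psi x : R -> R) (q beta a b : R)
  (tau_ge0 : forall t : R, 0 <= t -> 0 <= tau t)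
  (tau_continuous : {within `[0, +oo[, continuous tau})
  (tau_lag : t - tau t @[t --> +oo] --> +oo)
  (q_in01 : 0 < q < 1)
  (tau_ratio : tau t / t @[t --> +oo] --> q)
  (g_ge0 : forall u : R, 0 <= u -> 0 <= g u)
  (g_continuous : {within `[0, +oo[, continuous g})
  (g_at0 : g 0 = 0)
  (g_gt0 : forall u : R, 0 < u -> 0 < g u)
  (g_increasing : exists2 delta1 : R, 0 < delta1 &
     {in `]0, delta1[ &, nondecreasing_fun g})
  (beta_gt1 : 1 < beta)
  (g_RV : regularly_varying_at_zero beta g)
  (ab_gt0 : 0 < b < a)
  (ab_dominance : 0 < b * (1 / (1 - q)) `^ (beta / (beta - 1)) < a)
  (psi_continuous : {within `[- history_length tau, 0], continuous psi})
  (psi_gt0 : forall t : R, - history_length tau <= t <= 0 -> 0 < psi t)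
  (x_solution : is_solution a b g tau psi x)
  (x_to0 : x t @[t --> +oo] --> 0) :
  [/\ 0 < Lambda a b q beta,
      exists2 Lambda0 : R, 0 < Lambda0 &
        [/\ (Lambda0%:E <= liminf_at_infinity (fun t : R => (G g (x t) / t)%R))%E,
            (liminf_at_infinity (fun t : R => (G g (x t) / t)%R)
             <= limsup_at_infinity (fun t : R => (G g (x t) / t)%R))%E &
            (limsup_at_infinity (fun t : R => (G g (x t) / t)%R)
             <= (Lambda a b q beta `^ (- (beta - 1)))%:E)%E] &
      [/\ ((Lambda a b q beta)%:E
           <= liminf_at_infinity (fun t : R => (x t / Ginv g t)%R))%E,
          (liminf_at_infinity (fun t : R => (x t / Ginv g t)%R)
           <= limsup_at_infinity (fun t : R => (x t / Ginv g t)%R))%E &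
          (limsup_at_infinity (fun t : R => (x t / Ginv g t)%R) < +oo)%E]].
Proof.
case: x_solution => _ x_gt0 _ _ x_deriv.
have {}x_gt0 t : 0 <= t -> 0 < x t.
  move=> t0; apply: x_gt0; apply: le_trans t0.
  by rewrite oppr_le0 history_length_ge0.
have [delta1 delta1_gt0 g_nondecreasing] := g_increasing.
have b_gt0 : 0 < b by case/andP: ab_gt0.
have q1_gt0 : 0 < 1 - q by rewrite subr_gt0; case/andP: q_in01.
have b1_gt0 : 0 < beta - 1 by rewrite subr_gt0.
pose kappa := a - b * (1 - q) `^ (- (beta / (beta - 1))).
have powE : (1 / (1 - q)) `^ (beta / (beta - 1)) = (1 - q) `^ (- (beta / (beta - 1))).
  by rewrite div1r -[(1 - q)^-1]powR_inv1 ?ltW// -powRrM mulN1r.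
have kappa_gt0 : 0 < kappa.
  by case/andP: ab_dominance => _; rewrite powE subr_gt0.
have LambdaE : Lambda a b q beta = kappa `^ (- 1 / (beta - 1)) by rewrite /Lambda powE.
have Lambda_gt0 : 0 < Lambda a b q beta by rewrite LambdaE powR_gt0.
have Lambda_pow : Lambda a b q beta `^ (- (beta - 1)) = kappa.
  rewrite LambdaE -powRrM.
  have -> : - 1 / (beta - 1) * - (beta - 1) = 1 by field; rewrite gt_eqF.
  by rewrite powRr1; [|exact: ltW].
have [lambda lambda_gt0 y_ge] := G_solution_lower tau_ge0 tau_lag q_in01 tau_ratio
  g_continuous g_gt0 delta1_gt0 g_nondecreasing beta_gt1 g_RV b_gt0 x_gt0 x_deriv
  x_to0 kappa_gt0.
have y_le M : kappa < M -> \forall t \near +oo, G g (x t) <= M * t.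
  exact: (G_solution_upper tau_lag q_in01 tau_ratio
    g_continuous g_gt0 delta1_gt0 g_nondecreasing beta_gt1 g_RV b_gt0 x_gt0 x_deriv
    x_to0 kappa_gt0).
have x_near_gt0 : \forall t \near +oo, 0 < x t.
  near=> t; apply: x_gt0; near: t; exact: nbhs_pinfty_ge (num_real _).
split; first exact: Lambda_gt0.
  exists lambda; first exact: lambda_gt0.
  split; first exact: liminf_div_id_ge.
    exact: liminf_le_limsup_at_infinity.
  by rewrite Lambda_pow; exact: limsup_div_id_le.
split; last exact: (limsup_ratio_Ginv_lty g_continuous g_gt0 beta_gt1 g_RV lambda_gt0).
  exact: (liminf_ratio_Ginv_ge g_continuous g_gt0 beta_gt1 g_RV Lambda_gt0 Lambda_pow).
exact: liminf_le_limsup_at_infinity.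
Unshelve. all: by end_near. Qed.
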